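(* For every derivation $\Phi$ in the CoS system $\mathsf{SKSg}$ with premiss $\alpha$ and conclusion $\beta$ there is a $\mathsf{Frege}$ derivation $\Upsilon$ with premiss $\alpha$ and conclusion $\beta$; if $n$ is the size of $\Phi$, then the length and size of $\Upsilon$ are respectively $O(n^4)$ and $O(n^5)$.
   Context: CoS: formulae are built from units $\mathsf f,\mathsf t$, atoms $a,\bar a,\dots$, formula variables $A,\bar A,\dots$ by $[\alpha\vee\beta]$ and $(\alpha\wedge\beta)$; $\bar\cdot$ is an involution on atoms and on variables ($\bar a\ne a$); the De Morgan dual $\bar\alpha$ exchanges $\vee/\wedge$, $\mathsf t/\mathsf f$ and negates atoms and variables. Equality $=$ is the smallest context-closed equivalence containing commutativity and associativity of $\vee,\wedge$, $[\alpha\vee\mathsf f]=\alpha$, $(\alpha\wedge\mathsf t)=\alpha$, $[\mathsf t\vee\mathsf t]=\mathsf t$, $(\mathsf f\wedge\mathsf f)=\mathsf f$. A rule $\alpha/\beta$ has instances $\alpha\rho\sigma/\beta\rho\sigma$ for a renaming $\rho$ and substitution $\sigma$ (variables to formulae, $\bar A\mapsto$ dual); it generates steps $\xi\{\gamma\}/\xi\{\delta\}$ for any context (formula with one hole) $\xi$. A derivation in $\mathcal S$ with premiss $\alpha_0$ and conclusion $\alpha_k$ is a chain $\alpha_0,\dots,\alpha_k$ alternating $=$-steps and steps generated by rules of $\mathcal S$; its size is the number of occurrences of units, atoms and variables in it. $\mathsf{SKSg}$ has rules $\mathsf t/[A\vee\bar A]$, $(A\wedge\bar A)/\mathsf f$,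 $\mathsf f/A$, $A/\mathsf t$, $[A\vee A]/A$, $A/(A\wedge A)$, $(A\wedge[B\vee C])/[(A\wedge B)\vee C]$. $\mathsf{Frege}$: formulae over $\mathsf t,\mathsf f$, non-negated variables, $\vee,\wedge,\to,\neg$; axiom schemes $F_1: A\to(B\to(A\wedge B))$; $F_2:(A\wedge B)\to A$; $F_3:(A\wedge B)\to B$; $F_4:A\to(A\vee B)$; $F_5:B\to(A\vee B)$; $F_6:\neg\neg A\to A$; $F_7:A\to\neg\neg A$; $F_8:A\to(B\to A)$; $F_9:\neg A\to(A\to B)$; $F_{10}:(A\to(B\to C))\to((A\to B)\to(A\to C))$; $F_{11}:(A\to C)\to((B\to C)\to((A\vee B)\to C))$; $F_{12}:(A\to(B\to C))\to(B\to(A\to C))$; $F_{13}:(A\to B)\to(\neg B\to\neg A)$; $F_{14}:\mathsf f\to(A\wedge\neg A)$; $F_{15}:(A\wedge\neg A)\to\mathsf f$; $F_{16}:\mathsf t\to(A\vee\neg A)$; $F_{17}:(A\vee\neg A)\to\mathsf t$ (instances by substituting formulae), and modus ponens. A Frege derivation with given premisses is a sequence of formulae each of which is a premiss, an axiom instance, or follows by modus ponens from earlier ones; its length is the number of formulae, its size the number of occurrences of units and variables. Translation: CoS atoms/variables correspond to Frege variables, negated atoms/variables to $\neg$ of variables, $\vee,\wedge$ to themselves (and Frege $\alpha\to\beta$ to $[\bar\alpha\vee\beta]$). *)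

(* Defs.v *)
From mathcomp Require Import all_boot.
Set Implicit Arguments.
Unset Strict Implicit.
Unset Printing Implicit Defensive.

(** * The calculus of structures *)

(** Atoms, and likewise formula variables, are signed names: the involution
    exchanges the signs and has no fixed point. *)
Inductive lit := Pos of nat | Neg of nat.

Definition bar (l : lit) : lit :=
  match l with Pos x => Neg x | Neg x => Pos x end.

Lemma barK : involutive bar.
Proof. by case. Qed.

Lemma bar_neq (l : lit) : bar l <> l.
Proof. by case: l. Qed.

Inductive form :=
  | Ff
  | Tt
  | Atom of lit
  | Var of lit
  | Or of form & form
  | And of form & form.

Fixpoint dual (a : form) : form :=
  match a with
  | Ff => Tt
  | Tt => Ff
  | Atom l => Atom (bar l)
  | Var l => Var (bar l)
  | Or b c => And (dual b) (dual c)
  | And b c => Or (dual b) (dual c)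
  end.

Fixpoint fsize (a : form) : nat :=
  match a with
  | Ff | Tt | Atom _ | Var _ => 1
  | Or b c | And b c => fsize b + fsize c
  end.

Inductive ctx :=
  | Hole
  | OrL of ctx & form
  | OrR of form & ctx
  | AndL of ctx & form
  | AndR of form & ctx.

Fixpoint fill (xi : ctx) (a : form) : form :=
  match xi with
  | Hole => a
  | OrL x b => Or (fill x a) b
  | OrR b x => Or b (fill x a)
  | AndL x b => And (fill x a) b
  | AndR b x => And b (fill x a)
  end.

Inductive feq : form -> form -> Prop :=
  | feq_refl a : feq a a
  | feq_sym a b : feq a b -> feq b a
  | feq_trans a b c : feq a b -> feq b c -> feq a c
  | feq_ctx xi a b : feq a b -> feq (fill xi a) (fill xi b)
  | feq_orC a b : feq (Or a b) (Or b a)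
  | feq_andC a b : feq (And a b) (And b a)
  | feq_orA a b c : feq (Or (Or a b) c) (Or a (Or b c))
  | feq_andA a b c : feq (And (And a b) c) (And a (And b c))
  | feq_orF a : feq (Or a Ff) a
  | feq_andT a : feq (And a Tt) a
  | feq_orTT : feq (Or Tt Tt) Tt
  | feq_andFF : feq (And Ff Ff) Ff.

(** A renaming is given by its values on positive atoms, a substitution by its
    values on positive variables; both are extended so as to commute with
    negation. *)
Definition rename_lit (rho : nat -> lit) (l : lit) : lit :=
  match l with Pos x => rho x | Neg x => bar (rho x) end.

Fixpoint rename (rho : nat -> lit) (a : form) : form :=
  match a with
  | Ff => Ff
  | Tt => Tt
  | Atom l => Atom (rename_lit rho l)
  | Var l => Var l
  | Or b c => Or (rename rho b) (rename rho c)
  | And b c => And (rename rho b) (rename rho c)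
  end.

Fixpoint subst (sigma : nat -> form) (a : form) : form :=
  match a with
  | Ff => Ff
  | Tt => Tt
  | Atom l => Atom l
  | Var (Pos x) => sigma x
  | Var (Neg x) => dual (sigma x)
  | Or b c => Or (subst sigma b) (subst sigma c)
  | And b c => And (subst sigma b) (subst sigma c)
  end.

Record rule := Rule { rule_premiss : form; rule_conclusion : form }.

Definition cos_system := rule -> Prop.

Definition rule_instance (r : rule) (c d : form) : Prop :=
  exists (rho : nat -> lit) (sigma : nat -> form),
    c = subst sigma (rename rho (rule_premiss r)) /\
    d = subst sigma (rename rho (rule_conclusion r)).

Definition rule_step (S : cos_system) (a b : form) : Prop :=
  exists (r : rule) (xi : ctx) (c d : form),
    [/\ S r, rule_instance r c d, a = fill xi c & b = fill xi d].

(** A chain a_0, ..., a_k is stored as a_0 and the list of its steps, the i-th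
    step being a_i together with a tag: [true] if a_i is obtained from a_(i-1)
    by a rule of the system, [false] if it is obtained by an =-step.  The
    chain may begin and end with either kind of step. *)
Record cos_chain := Chain { chain_head : form; chain_steps : seq (bool * form) }.

Fixpoint valid_steps (S : cos_system) (a : form) (s : seq (bool * form)) : Prop :=
  match s with
  | [::] => True
  | (by_rule, b) :: s' =>
      (if by_rule then rule_step S a b else feq a b) /\ valid_steps S b s'
  end.

Definition cos_derivation (S : cos_system) (alpha beta : form)
    (Phi : cos_chain) : Prop :=
  [/\ chain_head Phi = alpha,
      last (chain_head Phi) (unzip2 (chain_steps Phi)) = beta,
      valid_steps S (chain_head Phi) (chain_steps Phi)
    & sorted [rel k1 k2 : bool | k1 != k2] (unzip1 (chain_steps Phi))].

Definition cos_size (Phi : cos_chain) : nat :=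
  \sum_(a <- chain_head Phi :: unzip2 (chain_steps Phi)) fsize a.

Definition vA := Var (Pos 0).
Definition vA' := Var (Neg 0).
Definition vB := Var (Pos 1).
Definition vC := Var (Pos 2).

Inductive SKSg : cos_system :=
  | identity    : SKSg (Rule Tt (Or vA vA'))
  | cut         : SKSg (Rule (And vA vA') Ff)
  | weakening   : SKSg (Rule Ff vA)
  | coweakening : SKSg (Rule vA Tt)
  | contraction : SKSg (Rule (Or vA vA) vA)
  | cocontraction : SKSg (Rule vA (And vA vA))
  | switch      : SKSg (Rule (And vA (Or vB vC)) (Or (And vA vB) vC)).

(** * Frege systems *)

(** CoS atoms and CoS variables give rise to disjoint sorts of Frege
    variables. *)
Inductive fvar := AtomVar of nat | FormVar of nat.

Inductive fform :=
  | FF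
  | FT
  | FVar of fvar
  | FOr of fform & fform
  | FAnd of fform & fform
  | FImp of fform & fform
  | FNot of fform.

Declare Scope frege_scope.
Delimit Scope frege_scope with F.
Bind Scope frege_scope with fform.
Infix "-->" := FImp (at level 55, right associativity) : frege_scope.
Infix "\/" := FOr : frege_scope.
Infix "/\" := FAnd : frege_scope.
Notation "~ A" := (FNot A) : frege_scope.

Inductive frege_axiom : fform -> Prop :=
  | F1 A B    : frege_axiom (A --> (B --> (A /\ B)))
  | F2 A B    : frege_axiom ((A /\ B) --> A)
  | F3 A B    : frege_axiom ((A /\ B) --> B)
  | F4 A B    : frege_axiom (A --> (A \/ B))
  | F5 A B    : frege_axiom (B --> (A \/ B))
  | F6 A      : frege_axiom ((~ (~ A)) --> A)
  | F7 A      : frege_axiom (A --> (~ (~ A)))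
  | F8 A B    : frege_axiom (A --> (B --> A))
  | F9 A B    : frege_axiom ((~ A) --> (A --> B))
  | F10 A B C : frege_axiom ((A --> (B --> C)) --> ((A --> B) --> (A --> C)))
  | F11 A B C : frege_axiom ((A --> C) --> ((B --> C) --> ((A \/ B) --> C)))
  | F12 A B C : frege_axiom ((A --> (B --> C)) --> (B --> (A --> C)))
  | F13 A B   : frege_axiom ((A --> B) --> ((~ B) --> (~ A)))
  | F14 A     : frege_axiom (FF --> (A /\ (~ A)))
  | F15 A     : frege_axiom ((A /\ (~ A)) --> FF)
  | F16 A     : frege_axiom (FT --> (A \/ (~ A)))
  | F17 A     : frege_axiom ((A \/ (~ A)) --> FT).

Definition frege_justified (Gamma : fform -> Prop) (s : seq fform) (i : nat) : Prop :=
  let A := nth FT s i in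
  Gamma A \/ frege_axiom A \/
  exists j k, [/\ j < i, k < i & nth FT s k = FImp (nth FT s j) A].

Definition frege_derivation (Gamma : fform -> Prop) (B : fform)
    (Upsilon : seq fform) : Prop :=
  (forall i, i < size Upsilon -> frege_justified Gamma Upsilon i) /\
  exists s, Upsilon = rcons s B.

Fixpoint fform_size (A : fform) : nat :=
  match A with
  | FF | FT | FVar _ => 1
  | FOr B C | FAnd B C | FImp B C => fform_size B + fform_size C
  | FNot B => fform_size B
  end.

Definition frege_length (Upsilon : seq fform) : nat := size Upsilon.

Definition frege_size (Upsilon : seq fform) : nat :=
  \sum_(A <- Upsilon) fform_size A.

(** * Translation of CoS formulae into Frege formulae *)

Definition to_frege_lit (v : nat -> fvar) (l : lit) : fform :=
  match l with Pos x => FVar (v x) | Neg x => FNot (FVar (v x)) end.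

Fixpoint to_frege (a : form) : fform :=
  match a with
  | Ff => FF
  | Tt => FT
  | Atom l => to_frege_lit AtomVar l
  | Var l => to_frege_lit FormVar l
  | Or b c => FOr (to_frege b) (to_frege c)
  | And b c => FAnd (to_frege b) (to_frege c)
  end.

(* Main.v *)
Require Import Defs.
From mathcomp Require Import all_boot.
From mathcomp Require Import zify.

(** Every rule instance of [SKSg] is an implication with a Frege proof of
    linear length, and such implications lift through contexts at a constant
    cost per level; modus ponens then chains the steps.  The difficulty is an
    =-step, because [feq] does not bound the formulae that the equational
    reasoning goes through.  But the equations hold in every bounded lattice,
    and the order of free bounded lattices has a cut-free presentation, whose
    transitivity is a cut elimination.  Since its rules are additive, a cut-free
    proof of [a <= b] has at most [2 |a| |b|] nodes and mentions only
    subformulae of [a] and [b]. *)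

(** * The cut-free order of free bounded lattices, and cut elimination *)

Inductive lattice_le : form -> form -> Prop :=
  | le_bot b : lattice_le Ff b
  | le_top a : lattice_le a Tt
  | le_atom l : lattice_le (Atom l) (Atom l)
  | le_var l : lattice_le (Var l) (Var l)
  | le_orL a b c : lattice_le a c -> lattice_le b c -> lattice_le (Or a b) c
  | le_andR a b c : lattice_le a b -> lattice_le a c -> lattice_le a (And b c)
  | le_andL1 a b c : lattice_le a c -> lattice_le (And a b) c
  | le_andL2 a b c : lattice_le b c -> lattice_le (And a b) c
  | le_orR1 a b c : lattice_le a b -> lattice_le a (Or b c)
  | le_orR2 a b c : lattice_le a c -> lattice_le a (Or b c).

Local Hint Constructors lattice_le : core.

Lemma lattice_le_refl a : lattice_le a a.
Proof. by elim: a; auto. Qed.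

Lemma fsize_gt0 a : 0 < fsize a.
Proof. by elim: a => //= b IHb c IHc; lia. Qed.

Local Ltac sz a b := have := fsize_gt0 a; have := fsize_gt0 b; lia.

(** Cut elimination by induction on the total size of the three formulae. If the last rule on the
    left acts on [a], or the last rule on the right acts on [c], the cut moves above it. If both act
    on the middle formula [b], the cut is replaced by one on an immediate subformula of [b]. *)
Lemma lattice_le_trans b a c : lattice_le a b -> lattice_le b c -> lattice_le a c.
Proof.
have [n] := ubnP (fsize a + fsize b + fsize c).
elim: n a b c => // n IHn a b c le_n ab bc.
(* The induction hypothesis is restated with the sizes of the current triple, so that the case
   analyses on the two derivations specialise its bound as well. *)
have cut a' b' c' : fsize a' + fsize b' + fsize c' < fsize a + fsize b + fsize c ->
  lattice_le a' b' -> lattice_le b' c' -> lattice_le a' c'.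
  by move=> lt_n; apply: IHn; lia.
clear IHn le_n n.
case: ab bc cut => {a b}.
- by auto.
- move=> a; move E: Tt => t tc cut; case: tc E cut => //; try by auto.
  + move=> x y z K1 K2 eq; subst x => cut.
    by apply: le_andR; apply: (cut _ Tt) => //=; eauto; sz y z.
  + move=> x y z K eq; subst x => cut.
    by apply: le_orR1; apply: (cut _ Tt) => //=; eauto; sz y z.
  + move=> x y z K eq; subst x => cut.
    by apply: le_orR2; apply: (cut _ Tt) => //=; eauto; sz y z.
- by [].
- by [].
- by move=> a1 a2 b H1 H2 bc cut; apply: le_orL; apply: (cut _ b) => //=; sz a1 a2.
- move=> a b1 b2 H1 H2; move E: (And b1 b2) => b bc cut; case: bc E cut; try by [|auto].
  + move=> x y z K1 K2 eq; subst x => cut.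
    by apply: le_andR; apply: (cut _ (And b1 b2)) => //=; eauto; sz y z.
  (* Principal case: the right derivation uses only one conjunct, and the left one has a premiss for
     it. *)
  + by move=> x y z K [eq1 eq2]; subst x y => cut; apply: (cut _ b1) => //=; sz b1 b2.
  + by move=> x y z K [eq1 eq2]; subst x y => cut; apply: (cut _ b2) => //=; sz b1 b2.
  + move=> x y z K eq; subst x => cut.
    by apply: le_orR1; apply: (cut _ (And b1 b2)) => //=; eauto; sz y z.
  + move=> x y z K eq; subst x => cut.
    by apply: le_orR2; apply: (cut _ (And b1 b2)) => //=; eauto; sz y z.
- by move=> a1 a2 b H bc cut; apply: le_andL1; apply: (cut _ b) => //=; sz a1 a2.
- by move=> a1 a2 b H bc cut; apply: le_andL2; apply: (cut _ b) => //=; sz a1 a2.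
- move=> a b1 b2 H; move E: (Or b1 b2) => b bc cut; case: bc E cut; try by [|auto].
  + by move=> x y z K1 K2 [eq1 eq2]; subst x y => cut; apply: (cut _ b1) => //=; sz b1 b2.
  + move=> x y z K1 K2 eq; subst x => cut.
    by apply: le_andR; apply: (cut _ (Or b1 b2)) => //=; eauto; sz y z.
  + move=> x y z K eq; subst x => cut.
    by apply: le_orR1; apply: (cut _ (Or b1 b2)) => //=; eauto; sz y z.
  + move=> x y z K eq; subst x => cut.
    by apply: le_orR2; apply: (cut _ (Or b1 b2)) => //=; eauto; sz y z.
- move=> a b1 b2 H; move E: (Or b1 b2) => b bc cut; case: bc E cut; try by [|auto].
  + by move=> x y z K1 K2 [eq1 eq2]; subst x y => cut; apply: (cut _ b2) => //=; sz b1 b2.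
  + move=> x y z K1 K2 eq; subst x => cut.
    by apply: le_andR; apply: (cut _ (Or b1 b2)) => //=; eauto; sz y z.
  + move=> x y z K eq; subst x => cut.
    by apply: le_orR1; apply: (cut _ (Or b1 b2)) => //=; eauto; sz y z.
  + move=> x y z K eq; subst x => cut.
    by apply: le_orR2; apply: (cut _ (Or b1 b2)) => //=; eauto; sz y z.
Qed.

Lemma lattice_le_fill xi a b :
  lattice_le a b -> lattice_le (fill xi a) (fill xi b).
Proof.
by have := lattice_le_refl; move=> ? ?; elim: xi => //= *;
  [apply: le_orL | apply: le_orL | apply: le_andR | apply: le_andR]; auto.
Qed.

(** Mutual [lattice_le] is a congruence, and all the equations hold in bounded lattices; the two
    unit equations are instances of idempotence. Transitivity of [feq] is where cut elimination
    removes the intermediate formulae, whose sizes are not controlled. *)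
Lemma feq_lattice_le a b : feq a b -> lattice_le a b /\ lattice_le b a.
Proof.
have r := lattice_le_refl.
elim => {a b}; try by move=> *; split; auto 7.
- by move=> a b _ [].
- by move=> a b c _ [ab ba] _ [bc cb]; split; apply: (lattice_le_trans b).
- by move=> xi a b _ [ab ba]; split; apply: lattice_le_fill.
Qed.

(** * Tree-like Frege proofs with bounded lines, and their linearisation *)

(** [prf Gamma K n A]: [A] has a tree-like Frege proof from [Gamma] with at most
    [n] lines, all of size at most [K]. *)
Inductive prf (Gamma : fform -> Prop) (K : nat) : nat -> fform -> Prop :=
  | prf_line n A : Gamma A \/ frege_axiom A -> fform_size A <= K -> 0 < n ->
      prf Gamma K n A
  | prf_mp n1 n2 n A B : prf Gamma K n1 (FImp A B) -> prf Gamma K n2 A ->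
      fform_size B <= K -> n1 + n2 < n -> prf Gamma K n B.

Lemma frege_justified_catl Gamma s t i :
  i < size s -> frege_justified Gamma s i -> frege_justified Gamma (s ++ t) i.
Proof.
move=> lt_i; rewrite /frege_justified nth_cat lt_i => -[|[|[j [k [lt_j lt_k E]]]]].
- by left.
- by right; left.
- by right; right; exists j, k; rewrite !nth_cat (ltn_trans lt_j lt_i) (ltn_trans lt_k lt_i).
Qed.

Lemma frege_justified_catr Gamma s t i :
  frege_justified Gamma t i -> frege_justified Gamma (s ++ t) (size s + i).
Proof.
have nthD j : nth FT (s ++ t) (size s + j) = nth FT t j.
  by rewrite nth_cat ltnNge leq_addr /= addKn.
rewrite /frege_justified nthD => -[|[|[j [k [lt_j lt_k E]]]]].
- by left.
- by right; left.
- by right; right; exists (size s + j), (size s + k); rewrite !nthD !ltn_add2l.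
Qed.

Lemma frege_derivation_mp Gamma A B s t :
  frege_derivation Gamma (FImp A B) s -> frege_derivation Gamma A t ->
  frege_derivation Gamma B (rcons (s ++ t) B).
Proof.
move=> [js [s' Es]] [jt [t' Et]]; split; last by exists (s ++ t).
have szs : size s = (size s').+1 by rewrite Es size_rcons.
have szt : size t = (size t').+1 by rewrite Et size_rcons.
have lt_A : size s + size t' < size (s ++ t) by rewrite size_cat; lia.
have lt_AB : size s' < size (s ++ t) by rewrite size_cat; lia.
move=> i; rewrite size_rcons ltnS leq_eqVlt => /orP[/eqP ->|lt_i].
  (* The minor premiss [A] is the last line of [t], shifted by the length of [s]; the implication is
     the last line of [s]. *)
  right; right; exists (size s + size t'), (size s'); split => //.
  rewrite !nth_rcons lt_A lt_AB ltnn eqxx !nth_cat {1}szs ltnSn.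
  by rewrite ltnNge leq_addr addKn Es Et !nth_rcons !ltnn !eqxx.
rewrite -cats1; apply: frege_justified_catl => //.
have [lt_s|le_s] := ltnP i (size s).
  by apply: frege_justified_catl => //; apply: js.
rewrite -(subnKC le_s); apply: frege_justified_catr; apply: jt.
by move: lt_i; rewrite size_cat; lia.
Qed.

(** The nodes of the tree are listed in post-order, premisses before conclusions; at most [n] lines
    of size at most [K] give the size bound. *)
Lemma prf_derivation Gamma K n A : prf Gamma K n A ->
  exists s, [/\ frege_derivation Gamma A s, frege_length s <= n
              & frege_size s <= n * K].
Proof.
rewrite /frege_length /frege_size.
elim => {n A} [n A jA leK n_gt0|n1 n2 n A B _ [s [ds ls zs]] _ [t [dt lt zt]] leK lt_n].
  exists [:: A]; split => //; last by rewrite big_seq1 (leq_trans leK) ?leq_pmull.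
  split; last by exists [::].
  by case=> //= _; case: jA => [|ax]; [left | right; left].
exists (rcons (s ++ t) B); split; first exact: frege_derivation_mp ds dt.
  by rewrite size_rcons size_cat; lia.
rewrite -cats1 !big_cat big_seq1 /=.
have : (n1 + n2).+1 * K <= n * K by rewrite leq_mul2r lt_n orbT.
rewrite mulSn mulnDl; lia.
Qed.

Lemma fform_size_gt0 A : 0 < fform_size A.
Proof. by elim: A => //= *; lia. Qed.

(** * Derived Frege rules of constant cost *)

Section DerivedRules.

Variables (Gamma : fform -> Prop) (K : nat).

Local Notation prf := (prf Gamma K).
Local Notation sz := fform_size.
Local Ltac fsz := rewrite /=; lia.

Lemma prf_leq m n A : prf m A -> m <= n -> prf n A.
Proof.
case=> {m A} [m A|n1 n2 m A B] H1 H2 H3 => [|lt_m] le_mn.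
  by apply: prf_line => //; lia.
by apply: (prf_mp _ _ _ _ _ _ _ H1 H2) => //; lia.
Qed.

Lemma prf_ax A : frege_axiom A -> sz A <= K -> prf 1 A.
Proof. by move=> ax leK; apply: prf_line => //; right. Qed.

Lemma prf_detach n1 n2 A B :
  prf n1 (A --> B)%F -> prf n2 A -> sz B <= K -> prf (n1 + n2 + 1) B.
Proof. by move=> H1 H2 leK; apply: (prf_mp _ _ _ _ _ _ _ H1 H2) => //; lia. Qed.

Lemma prf_const n A B : prf n B -> sz A + 2 * sz B <= K -> prf (n + 2) (A --> B)%F.
Proof.
move=> H leK; apply: (prf_leq (1 + n + 1)); last lia.
by apply: prf_detach H _; [apply: prf_ax; [exact: F8 | fsz] | fsz].
Qed.

Lemma prf_id A : 9 * sz A <= K -> prf 5 (A --> A)%F.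
Proof.
move=> leK.
have H1 : prf 1 (A --> ((A --> A) --> A))%F by apply: prf_ax; [exact: F8 | fsz].
have H2 : prf 1 (A --> (A --> A))%F by apply: prf_ax; [exact: F8 | fsz].
(* The combinator identity I = SKK: the instance of [F10] with middle formula [A --> A] has size
   nine times that of [A], whence the bound on [K]. *)
apply: (prf_detach 3 1 _ _ _ H2); last by fsz.
by apply: (prf_detach 1 1 _ _ _ H1); [apply: prf_ax; [exact: F10 | fsz] | fsz].
Qed.

(** [F10] is modus ponens under the hypothesis [A], and the condition on [K] is the size of the
    instance used. In the other derived rules too, this condition makes room for the intermediate
    lines. *)
Lemma prf_app n1 n2 A B C :
  prf n1 (A --> (B --> C))%F -> prf n2 (A --> B)%F ->
  3 * sz A + 2 * sz B + 2 * sz C <= K -> prf (n1 + n2 + 3) (A --> C)%F.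
Proof.
move=> H1 H2 leK; apply: (prf_leq ((1 + n1 + 1) + n2 + 1)); last lia.
apply: (prf_detach _ _ _ _ _ H2); last by fsz.
by apply: (prf_detach _ _ _ _ _ H1); [apply: prf_ax; [exact: F10 | fsz] | fsz].
Qed.

Lemma prf_trans n1 n2 A B C :
  prf n1 (A --> B)%F -> prf n2 (B --> C)%F ->
  3 * sz A + 2 * sz B + 2 * sz C <= K -> prf (n1 + n2 + 5) (A --> C)%F.
Proof.
move=> H1 H2 leK; apply: (prf_leq ((n2 + 2) + n1 + 3)); last lia.
by apply: prf_app (prf_const _ _ _ H2 _) H1 _; fsz.
Qed.

Lemma prf_swap n A B C :
  prf n (A --> (B --> C))%F -> 2 * (sz A + sz B + sz C) <= K ->
  prf (n + 2) (B --> (A --> C))%F.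
Proof.
move=> H leK; apply: (prf_leq (1 + n + 1)); last lia.
by apply: prf_detach H _; [apply: prf_ax; [exact: F12 | fsz] | fsz].
Qed.

Lemma prf_trans2 n1 n2 A B C D :
  prf n1 (A --> (B --> C))%F -> prf n2 (C --> D)%F ->
  3 * sz A + 4 * sz B + 4 * sz C + 4 * sz D <= K ->
  prf (n1 + n2 + 9) (A --> (B --> D))%F.
Proof.
move=> H1 H2 leK; apply: (prf_leq (n1 + (1 + (n2 + 2) + 1) + 5)); last lia.
apply: (prf_trans _ _ _ _ _ H1); last by fsz.
apply: prf_detach (prf_const _ B _ H2 _) _; try by fsz.
by apply: prf_ax; [exact: F10 | fsz].
Qed.

Lemma prf_orE n1 n2 A B C :
  prf n1 (A --> C)%F -> prf n2 (B --> C)%F ->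
  2 * sz A + 2 * sz B + 3 * sz C <= K -> prf (n1 + n2 + 3) ((A \/ B) --> C)%F.
Proof.
move=> H1 H2 leK; apply: (prf_leq ((1 + n1 + 1) + n2 + 1)); last lia.
apply: (prf_detach _ _ _ _ _ H2); last by fsz.
by apply: (prf_detach _ _ _ _ _ H1); [apply: prf_ax; [exact: F11 | fsz] | fsz].
Qed.

Lemma prf_andI n1 n2 A B C :
  prf n1 (C --> A)%F -> prf n2 (C --> B)%F ->
  4 * sz A + 4 * sz B + 3 * sz C <= K -> prf (n1 + n2 + 9) (C --> (A /\ B))%F.
Proof.
move=> H1 H2 leK; apply: (prf_leq ((n1 + 1 + 5) + n2 + 3)); last lia.
apply: (prf_app _ _ _ _ _ _ H2); last by fsz.
by apply: (prf_trans _ _ _ _ _ H1); [apply: prf_ax; [exact: F1 | fsz] | fsz].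
Qed.

Lemma prf_uncurry n A B C :
  prf n (A --> (B --> C))%F -> 5 * sz A + 5 * sz B + 2 * sz C <= K ->
  prf (n + 10) ((A /\ B) --> C)%F.
Proof.
move=> H leK; apply: (prf_leq ((1 + n + 5) + 1 + 3)); last lia.
apply: (prf_app _ _ _ B); [|by apply: prf_ax; [exact: F3 | fsz]|by fsz].
by apply: prf_trans H _; [apply: prf_ax; [exact: F2 | fsz] | fsz].
Qed.

Lemma prf_orC n A B : prf n (A \/ B)%F -> 5 * sz A + 5 * sz B <= K ->
  prf (n + 10) (B \/ A)%F.
Proof.
move=> H leK; apply: (prf_leq ((1 + 1 + 3) + n + 1)); last lia.
apply: (prf_detach _ _ _ _ _ H); last by fsz.
apply: prf_orE; last by fsz.
- by apply: prf_ax; [exact: F5 | fsz].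
- by apply: prf_ax; [exact: F4 | fsz].
Qed.

(** [F17] yields [FT] from any excluded middle. One is available without hypotheses: for an axiom
    [X], [F7] proves its double negation, and [F5] weakens that to a disjunction. *)
Lemma prf_true : 20 <= K -> prf 7 FT.
Proof.
move=> leK; pose X := (FF --> (FF --> FF))%F.
have HX : prf 1 X by apply: prf_ax; [exact: F8 | fsz].
have HNNX : prf 3 (~ ~ X)%F.
  by apply: (prf_detach 1 1 _ _ _ HX); [apply: prf_ax; [exact: F7 | fsz] | fsz].
have Hor : prf 5 (~ X \/ ~ ~ X)%F.
  by apply: (prf_detach 1 3 _ _ _ HNNX); [apply: prf_ax; [exact: F5 | fsz] | fsz].
by apply: (prf_detach 1 5 _ _ _ Hor); [apply: prf_ax; [exact: F17 | fsz] | fsz].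
Qed.

(** [F14] turns [FF] into a contradiction, from which [F9] proves everything. Taking the
    contradiction on [FT] keeps its size constant. *)
Lemma prf_false_elim A : 5 * sz A + 20 <= K -> prf 19 (FF --> A)%F.
Proof.
move=> leK; apply: (prf_trans 1 13 _ (FT /\ ~ FT)%F); last by fsz.
  by apply: prf_ax; [exact: F14 | fsz].
apply: (prf_uncurry 3); last by fsz.
apply: (prf_swap 1); last by fsz.
by apply: prf_ax; [exact: F9 | fsz].
Qed.

Lemma prf_or_monoL n A B C : prf n (A --> B)%F ->
  5 * sz A + 5 * sz B + 5 * sz C <= K -> prf (n + 10) ((A \/ C) --> (B \/ C))%F.
Proof.
move=> H leK; apply: (prf_leq ((n + 1 + 5) + 1 + 3)); last lia.
apply: prf_orE; [ | by apply: prf_ax; [exact: F5 | fsz] | by fsz].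
by apply: (prf_trans _ _ _ _ _ H); [apply: prf_ax; [exact: F4 | fsz] | fsz].
Qed.

Lemma prf_or_monoR n A B C : prf n (A --> B)%F ->
  5 * sz A + 5 * sz B + 5 * sz C <= K -> prf (n + 10) ((C \/ A) --> (C \/ B))%F.
Proof.
move=> H leK; apply: (prf_leq (1 + (n + 1 + 5) + 3)); last lia.
apply: prf_orE; [by apply: prf_ax; [exact: F4 | fsz] | | by fsz].
by apply: (prf_trans _ _ _ _ _ H); [apply: prf_ax; [exact: F5 | fsz] | fsz].
Qed.

Lemma prf_and_preL n A B C : prf n (A --> C)%F ->
  5 * sz A + 3 * sz B + 2 * sz C <= K -> prf (n + 6) ((A /\ B) --> C)%F.
Proof.
move=> H leK; apply: (prf_leq (1 + n + 5)); last lia.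
by apply: prf_trans H _; [apply: prf_ax; [exact: F2 | fsz] | fsz].
Qed.

Lemma prf_and_preR n A B C : prf n (B --> C)%F ->
  3 * sz A + 5 * sz B + 2 * sz C <= K -> prf (n + 6) ((A /\ B) --> C)%F.
Proof.
move=> H leK; apply: (prf_leq (1 + n + 5)); last lia.
by apply: prf_trans H _; [apply: prf_ax; [exact: F3 | fsz] | fsz].
Qed.

Lemma prf_and_monoL n A B C : prf n (A --> B)%F ->
  10 * sz A + 10 * sz B + 10 * sz C <= K ->
  prf (n + 16) ((A /\ C) --> (B /\ C))%F.
Proof.
move=> H leK; apply: (prf_leq ((n + 6) + 1 + 9)); last lia.
apply: prf_andI; [by apply: prf_and_preL H _; fsz | | by fsz].
by apply: prf_ax; [exact: F3 | fsz].
Qed.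

Lemma prf_and_monoR n A B C : prf n (A --> B)%F ->
  10 * sz A + 10 * sz B + 10 * sz C <= K ->
  prf (n + 16) ((C /\ A) --> (C /\ B))%F.
Proof.
move=> H leK; apply: (prf_leq (1 + (n + 6) + 9)); last lia.
apply: prf_andI; [ | by apply: prf_and_preR H _; fsz | by fsz].
by apply: prf_ax; [exact: F2 | fsz].
Qed.

Lemma prf_switch A B C : 20 * (sz A + sz B + sz C) <= K ->
  prf 50 ((A /\ (B \/ C)) --> ((A /\ B) \/ C))%F.
Proof.
move=> leK; apply: (prf_leq ((((1 + 1 + 9) + 2) + (1 + 1 + 5) + 3) + 2 + 10)) => //.
apply: prf_uncurry; last by fsz.
apply: prf_swap; last by fsz.
apply: prf_orE; last by fsz.
- apply: prf_swap; last by fsz.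
  by apply: (prf_trans2 _ _ _ _ (A /\ B)%F);
    [apply: prf_ax; [exact: F1 | fsz] | apply: prf_ax; [exact: F4 | fsz] | fsz].
- by apply: (prf_trans _ _ _ ((A /\ B) \/ C)%F);
    [apply: prf_ax; [exact: F5 | fsz] | apply: prf_ax; [exact: F8 | fsz] | fsz].
Qed.

(** The inductive step of excluded middle, with [A'] and [B'] in the role of the duals. The goal [G]
    follows from [A], from [B], and from [A'] and [B'] together; so a case analysis on [B \/ B']
    proves it under [A'], and then one on [A \/ A'] outright. *)
Lemma prf_or_and n1 n2 A A' B B' : prf n1 (A \/ A')%F -> prf n2 (B \/ B')%F ->
  30 * (sz A + sz A' + sz B + sz B') <= K ->
  prf (n1 + n2 + 100) ((A \/ B) \/ (A' /\ B'))%F.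
Proof.
move=> H1 H2 leK; set G := ((A \/ B) \/ (A' /\ B'))%F.
have HA : prf 7 (A --> G)%F.
  by apply: (prf_trans 1 1 _ (A \/ B)%F);
    [apply: prf_ax; [exact: F4 | fsz] | apply: prf_ax; [exact: F4 | fsz] | fsz].
have HB : prf 7 (B --> G)%F.
  by apply: (prf_trans 1 1 _ (A \/ B)%F);
    [apply: prf_ax; [exact: F5 | fsz] | apply: prf_ax; [exact: F4 | fsz] | fsz].
have HA'B' : prf 11 (A' --> (B' --> G))%F.
  by apply: (prf_trans2 1 1 _ _ (A' /\ B')%F);
    [apply: prf_ax; [exact: F1 | fsz] | apply: prf_ax; [exact: F5 | fsz] | fsz].
have HB'A' : prf 13 (B' --> (A' --> G))%F by apply: prf_swap HA'B' _; fsz.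
have HBA' : prf 13 (B --> (A' --> G))%F.
  by apply: (prf_trans 7 1 _ _ _ HB); [apply: prf_ax; [exact: F8 | fsz] | fsz].
have HA' : prf (29 + n2 + 1) (A' --> G)%F.
  by apply: prf_detach H2 _; [apply: (prf_orE 13 13) | ]; try fsz.
apply: (prf_leq ((7 + (29 + n2 + 1) + 3) + n1 + 1)); last lia.
by apply: prf_detach H1 _; [apply: prf_orE HA HA' _ | ]; fsz.
Qed.

(** The inductive step of non-contradiction: each disjunct on the left clashes with the
    corresponding conjunct on the right. *)
Lemma prf_and_or_false n1 n2 A A' B B' :
  prf n1 (A --> (A' --> FF))%F -> prf n2 (B --> (B' --> FF))%F ->
  30 * (sz A + sz A' + sz B + sz B') <= K ->
  prf (n1 + n2 + 50) ((A \/ B) --> ((A' /\ B') --> FF))%F.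
Proof.
move=> H1 H2 leK.
have A_gt0 := fform_size_gt0 A.
apply: (prf_leq ((n1 + 2 + 6 + 2) + (n2 + 2 + 6 + 2) + 3)); last lia.
apply: prf_orE; last by fsz.
- apply: prf_swap; last by fsz.
  by apply: prf_and_preL; [apply: prf_swap H1 _ |]; fsz.
- apply: prf_swap; last by fsz.
  by apply: prf_and_preR; [apply: prf_swap H2 _ |]; fsz.
Qed.

End DerivedRules.

(** * Frege proofs of lattice inequalities, rule instances and their closure under contexts *)

Lemma fform_size_to_frege a : fform_size (to_frege a) = fsize a.
Proof. by elim: a => //= [[]//|[]//|b -> c ->|b -> c ->]. Qed.

Lemma fsize_dual a : fsize (dual a) = fsize a.
Proof. by elim: a => //= b -> c ->. Qed.

Section ToFrege.

Variables (Gamma : fform -> Prop) (K : nat).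

Local Notation prf := (prf Gamma K).
Local Ltac fsz :=
  first [eassumption | rewrite /= ?fform_size_to_frege ?fsize_dual; lia].

(** The product of the sizes is additive in each argument, so the bounds of two premisses add up to
    that of the conclusion, and the spare 30 pays for the new lines. With one premiss, the
    subformula that is added contributes at least 60. *)
Lemma prf_lattice_le a b : lattice_le a b -> 100 * (fsize a + fsize b) <= K ->
  exists2 n, n + 30 <= 60 * (fsize a * fsize b) &
    prf n (to_frege a --> to_frege b)%F.
Proof.
elim => {a b} /=.
- move=> b leK; exists 19; first by have := fsize_gt0 b; lia.
  by apply: prf_false_elim; fsz.
- move=> a leK; exists 9; first by have := fsize_gt0 a; lia.
  by apply: (prf_const _ _ 7); [apply: prf_true | ]; fsz.
- by move=> l leK; exists 5 => //; apply: prf_id; case: l => x; fsz.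
- by move=> l leK; exists 5 => //; apply: prf_id; case: l => x; fsz.
- move=> a b c _ IHa _ IHb leK.
  have [|n1 le1 H1] := IHa; first lia.
  have [|n2 le2 H2] := IHb; first lia.
  by exists (n1 + n2 + 3); [rewrite mulnDl; lia | apply: prf_orE; fsz].
- move=> a b c _ IHb _ IHc leK.
  have [|n1 le1 H1] := IHb; first lia.
  have [|n2 le2 H2] := IHc; first lia.
  by exists (n1 + n2 + 9); [rewrite mulnDr; lia | apply: prf_andI; fsz].
- move=> a b c _ IH leK; have [|n le_n H] := IH; first lia.
  have pos : 0 < fsize b * fsize c by rewrite muln_gt0 !fsize_gt0.
  by exists (n + 6); [rewrite mulnDl; lia | apply: prf_and_preL; fsz].
- move=> a b c _ IH leK; have [|n le_n H] := IH; first lia.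
  have pos : 0 < fsize a * fsize c by rewrite muln_gt0 !fsize_gt0.
  by exists (n + 6); [rewrite mulnDl; lia | apply: prf_and_preR; fsz].
- move=> a b c _ IH leK; have [|n le_n H] := IH; first lia.
  have pos : 0 < fsize a * fsize c by rewrite muln_gt0 !fsize_gt0.
  exists (n + 1 + 5); first by rewrite mulnDr; lia.
  by apply: prf_trans H _ _; [apply: prf_ax; [exact: F4 | fsz] | fsz].
- move=> a b c _ IH leK; have [|n le_n H] := IH; first lia.
  have pos : 0 < fsize a * fsize b by rewrite muln_gt0 !fsize_gt0.
  exists (n + 1 + 5); first by rewrite mulnDr; lia.
  by apply: prf_trans H _ _; [apply: prf_ax; [exact: F5 | fsz] | fsz].
Qed.

(** The dual pushes negation down to the literals and is not a Frege negation. Hence the law is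
    proved for variables by [F16] and carried upwards by [prf_or_and]; for a conjunction the
    disjuncts are exchanged before and after. *)
Lemma prf_excluded_middle a : 100 * fsize a <= K ->
  exists2 n, n + 130 <= 260 * fsize a & prf n (to_frege a \/ to_frege (dual a))%F.
Proof.
have lit_em (v : fvar) : 100 <= K -> prf 9 (FVar v \/ ~ FVar v)%F.
  move=> leK; apply: (prf_detach _ _ 1 7 FT); last by fsz.
    by apply: prf_ax; [exact: F16 | fsz].
  by apply: prf_true; lia.
have lit_em' (v : fvar) : 100 <= K -> prf 19 (~ FVar v \/ FVar v)%F.
  by move=> leK; apply: (prf_orC _ _ 9); [apply: lit_em | fsz].
elim: a => /=.
- move=> leK; exists 9 => //; apply: (prf_detach _ _ 1 7 FT); last by fsz.
    by apply: prf_ax; [exact: F5 | fsz].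
  by apply: prf_true; lia.
- move=> leK; exists 9 => //; apply: (prf_detach _ _ 1 7 FT); last by fsz.
    by apply: prf_ax; [exact: F4 | fsz].
  by apply: prf_true; lia.
- by move=> [x|x] leK; [exists 9 | exists 19] => //=; auto.
- by move=> [x|x] leK; [exists 9 | exists 19] => //=; auto.
- move=> a IHa b IHb leK.
  have [|n1 le1 H1] := IHa; first lia.
  have [|n2 le2 H2] := IHb; first lia.
  by exists (n1 + n2 + 100); [lia | apply: prf_or_and; fsz].
- move=> a IHa b IHb leK.
  have [|n1 le1 H1] := IHa; first lia.
  have [|n2 le2 H2] := IHb; first lia.
  (* The overhead of this case is exactly 130, the offset in the statement. *)
  exists (((n1 + 10) + (n2 + 10) + 100) + 10); first lia.
  by apply: prf_orC; [apply: prf_or_and; [apply: prf_orC H1 _ | apply: prf_orC H2 _ |] |]; fsz.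
Qed.

Lemma prf_contradiction a : 100 * fsize a <= K ->
  exists2 n, n + 60 <= 120 * fsize a &
    prf n (to_frege a --> (to_frege (dual a) --> FF))%F.
Proof.
have lit_nc (v : fvar) : 100 <= K -> prf 11 (FVar v --> ((~ FVar v) --> FF))%F.
  move=> leK; apply: (prf_trans2 _ _ 1 1 _ _ (FVar v /\ ~ FVar v)%F); last by fsz.
    by apply: prf_ax; [exact: F1 | fsz].
  by apply: prf_ax; [exact: F15 | fsz].
have lit_nc' (v : fvar) : 100 <= K -> prf 13 ((~ FVar v) --> (FVar v --> FF))%F.
  by move=> leK; apply: (prf_swap _ _ 11); [apply: lit_nc | fsz].
elim: a => /=.
- by move=> leK; exists 1 => //; apply: prf_ax; [exact: F8 | fsz].
- by move=> leK; exists 7 => //; apply: (prf_const _ _ 5); [apply: prf_id | ]; fsz.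
- by move=> [x|x] leK; [exists 11 | exists 13] => //=; auto.
- by move=> [x|x] leK; [exists 11 | exists 13] => //=; auto.
- move=> a IHa b IHb leK.
  have [|n1 le1 H1] := IHa; first lia.
  have [|n2 le2 H2] := IHb; first lia.
  by exists (n1 + n2 + 50); [lia | apply: prf_and_or_false; fsz].
- move=> a IHa b IHb leK.
  have [|n1 le1 H1] := IHa; first lia.
  have [|n2 le2 H2] := IHb; first lia.
  exists ((n1 + 2) + (n2 + 2) + 50 + 2); first lia.
  apply: prf_swap; last by fsz.
  by apply: prf_and_or_false; [apply: prf_swap H1 _ | apply: prf_swap H2 _ |]; fsz.
Qed.

(** Identity and cut need proofs of length linear in the formula substituted for [A]; the other five
    rules have proofs of constant length. *)
Lemma prf_rule_instance r c d : SKSg r -> rule_instance r c d ->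
  100 * (fsize c + fsize d) <= K ->
  exists2 n, n <= 300 * (fsize c + fsize d) &
    prf n (to_frege c --> to_frege d)%F.
Proof.
case; move=> [rho [sigma [-> ->]]] /=;
  move: (sigma 0) (sigma 1) (sigma 2) => a b e leK; have a_gt0 := fsize_gt0 a.
- have [|n le_n H] := prf_excluded_middle a; first by lia.
  by exists (n + 2); [rewrite fsize_dual; lia | apply: prf_const; fsz].
- have [|n le_n H] := prf_contradiction a; first by lia.
  by exists (n + 10); [rewrite fsize_dual; lia | apply: prf_uncurry; fsz].
- by exists 19; [lia | apply: prf_false_elim; fsz].
- exists 9; first lia.
  by apply: (prf_const _ _ 7); [apply: prf_true; lia | fsz].
- exists (5 + 5 + 3); first lia.
  by apply: prf_orE; [apply: prf_id | apply: prf_id | ]; fsz.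
- exists (5 + 5 + 9); first lia.
  by apply: prf_andI; [apply: prf_id | apply: prf_id | ]; fsz.
- by exists 50; [lia | apply: prf_switch; fsz].
Qed.

(** Each level of the context costs at most 16 lines and adds a formula of positive size, so the
    depth of the hole is bounded by the size of the filled context. *)
Lemma prf_fill xi c d n : prf n (to_frege c --> to_frege d)%F ->
  100 * (fsize (fill xi c) + fsize (fill xi d)) <= K ->
  prf (n + 16 * fsize (fill xi c)) (to_frege (fill xi c) --> to_frege (fill xi d))%F.
Proof.
move=> H; elim: xi => /= [|xi IH b|b xi IH|xi IH b|b xi IH] leK.
- by apply: prf_leq H _; lia.
- have pos := fsize_gt0 b; apply: (prf_leq _ _ (n + 16 * fsize (fill xi c) + 10)); last lia.
  by apply: prf_or_monoL; [apply: IH; lia | fsz].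
- have pos := fsize_gt0 b; apply: (prf_leq _ _ (n + 16 * fsize (fill xi c) + 10)); last lia.
  by apply: prf_or_monoR; [apply: IH; lia | fsz].
- have pos := fsize_gt0 b; apply: (prf_leq _ _ (n + 16 * fsize (fill xi c) + 16)); last lia.
  by apply: prf_and_monoL; [apply: IH; lia | fsz].
- have pos := fsize_gt0 b; apply: (prf_leq _ _ (n + 16 * fsize (fill xi c) + 16)); last lia.
  by apply: prf_and_monoR; [apply: IH; lia | fsz].
Qed.

(** * Simulation of single steps and of whole chains *)

Lemma fsize_fill_ge xi a : fsize a <= fsize (fill xi a).
Proof. by elim: xi => //= *; lia. Qed.

(** A rule step costs at most 600m lines for the instance and 16m for the context; an equality step
    costs at most 60 times the square of m. *)
Lemma prf_cos_step (by_rule : bool) a b m :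
  (if by_rule then rule_step SKSg a b else feq a b) ->
  fsize a <= m -> fsize b <= m -> 200 * m <= K ->
  prf (700 * m ^ 2) (to_frege a --> to_frege b)%F.
Proof.
case: by_rule => [[r [xi [c [d [Sr ri -> ->]]]]]|/feq_lattice_le[le_ab _]] le_a le_b leK.
  have lec := fsize_fill_ge xi c; have led := fsize_fill_ge xi d.
  have [|n le_n H] := prf_rule_instance _ _ _ Sr ri; first lia.
  apply: (prf_leq _ _ (n + 16 * fsize (fill xi c))); first by apply: prf_fill H _; lia.
  by have : m <= m ^ 2 by [rewrite -mulnn; nia]; lia.
have [|n le_n H] := prf_lattice_le _ _ le_ab; first lia.
apply: (prf_leq _ _ n) => //.
have : fsize a * fsize b <= m ^ 2 by rewrite -mulnn leq_mul.
lia.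
Qed.

(** The proof of the current formula serves exactly once, as minor premiss of the next modus ponens,
    so the tree form causes no duplication. The added 1 counts the line that this modus ponens
    yields. *)
Lemma prf_cos_steps m a s N :
  valid_steps SKSg a s -> prf N (to_frege a) ->
  (forall b, List.In b (a :: unzip2 s) -> fsize b <= m) -> 200 * m <= K ->
  prf (N + size s * (700 * m ^ 2 + 1)) (to_frege (last a (unzip2 s))).
Proof.
elim: s a N => [|[t b] s IH] a N /=; first by rewrite addn0.
move=> [st vs] H le_m leK.
have le_b : fsize b <= m by apply: le_m; right; left.
have H' : prf (700 * m ^ 2 + N + 1) (to_frege b).
  apply: (prf_detach _ _ _ _ (to_frege a)) H _; last by fsz.
  by apply: prf_cos_step st _ _ _ => //; apply: le_m; left.
apply: prf_leq (IH _ _ vs H' _ leK) _; last lia.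
by move=> x Hx; apply: le_m; right.
Qed.

End ToFrege.

(** * Counting in terms of the size of the derivation *)

Lemma leq_fsize_cos_size Phi b :
  List.In b (chain_head Phi :: unzip2 (chain_steps Phi)) -> fsize b <= cos_size Phi.
Proof.
rewrite /cos_size; elim: (_ :: _) => //= a s IH; rewrite big_cons.
by case=> [->|/IH]; lia.
Qed.

(** A chain of k steps has k + 1 formulae, each of size at least 1. *)
Lemma size_lt_cos_size Phi : size (chain_steps Phi) < cos_size Phi.
Proof.
rewrite /cos_size -(size_map snd) -/(unzip2 _) -[(size _).+1]/(size (chain_head Phi :: _)).
by rewrite -sum1_size; apply: leq_sum => a _; apply: fsize_gt0.
Qed.

Theorem theorem4p11 :
  exists c d : nat,
    forall (alpha beta : form) (Phi : cos_chain),
      cos_derivation SKSg alpha beta Phi ->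
      exists Upsilon : seq fform,
        [/\ frege_derivation (fun A => A = to_frege alpha) (to_frege beta) Upsilon,
            frege_length Upsilon <= c * cos_size Phi ^ 4
          & frege_size Upsilon <= d * cos_size Phi ^ 5].
Proof.
(* The length is at most 700 times the cube of n, plus n for the modus ponens lines, plus 1 for the
   premiss: hence 702. Lines have size at most 200n, which gives the other constant. *)
exists 702, (702 * 200) => alpha beta Phi [Ealpha Ebeta vs _].
have le_m := leq_fsize_cos_size Phi; have lt_n := size_lt_cos_size Phi.
move: vs le_m lt_n; rewrite -Ebeta Ealpha; move: (cos_size Phi) => n vs le_m lt_n.
have H : prf (fun A => A = to_frege alpha) (200 * n) 1 (to_frege alpha).
  apply: prf_line => //; first by left.
  by rewrite fform_size_to_frege; have := le_m alpha (or_introl erefl); lia.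
have [Upsilon [dU lU sU]] :=
  prf_derivation _ _ _ _ (prf_cos_steps _ _ n alpha _ 1 vs H le_m (leqnn _)).
have le_N : 1 + size (chain_steps Phi) * (700 * n ^ 2 + 1) <= 702 * n ^ 4.
  have e1 : size (chain_steps Phi) * (700 * n ^ 2 + 1) <= n * (700 * n ^ 2 + 1).
    by rewrite leq_mul2r ltnW ?orbT.
  have e2 : n * (700 * n ^ 2 + 1) = 700 * n ^ 3 + n by rewrite mulnDr muln1 mulnCA -expnS.
  have e3 : n ^ 3 <= n ^ 4 by rewrite leq_pexp2l //; lia.
  have e4 : n ^ 1 <= n ^ 4 by rewrite leq_pexp2l //; lia.
  by move: e4; rewrite expn1; lia.
exists Upsilon; split => //; first exact: leq_trans lU le_N.
apply: leq_trans sU _; apply: leq_trans (leq_mul le_N (leqnn _)) _.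
by rewrite [n ^ 5]expnSr; lia.
Qed.
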